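(* Let $D=(V,A)$ be a weakly connected digraph and, for $i=1,2$, let $\mathcal{C}_i$ be a crossing family over ground set $V$ and $f_i:\mathcal{C}_i\to\mathbb{Z}$ be a crossing submodular function. Then the linear system $$y(\delta^+(U))-y(\delta^-(U))\leq f_i(U)\quad\forall U\in\mathcal{C}_i,\ i=1,2$$ in variables $y\in\mathbb{R}^A$ is totally dual integral (TDI), and in particular, the polyhedron $P\subseteq\mathbb{R}^A$ of its solutions is integral.
   Context: Digraphs are finite and may have parallel arcs. A digraph is weakly connected if its underlying undirected graph is connected. For a digraph $D=(V,A)$ and $U\subseteq V$, $\delta^+(U)$ and $\delta^-(U)$ denote the sets of arcs leaving and entering $U$, respectively. For $y\in\mathbb{R}^A$ and $B\subseteq A$, $y(B):=\sum_{a\in B}y_a$. A family $\mathcal{C}$ of subsets of $V$ is a crossing family over ground set $V$ if for all $U,W\in\mathcal{C}$ with $U\cap W\neq\emptyset$ and $U\cup W\neq V$ we have $U\cap W,\,U\cup W\in\mathcal{C}$. A function $f:\mathcal{C}\to\mathbb{R}$ is crossing submodular over $\mathcal{C}$ if $f(U\cap W)+f(U\cup W)\leq f(U)+f(W)$ for all $U,W\in\mathcal{C}$ with $U\cap W\neq\emptyset$ and $U\cup W\neq V$. A linear system $Bx\leq b$ (with $B\in\mathbb{Q}^{m\times n}$, $b\in\mathbb{Q}^m$) is totally dual integral (TDI) if for each $w\in\mathbb{Z}^n$, the dual of the linear program $\max\{w^\top x: Bx\leq b\}$ has an integral optimal solution whenever the linear program admits an optimum. A polyhedron is integral if every non-empty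 face of it contains an integral point. *)

(* Defs.v *)
(* The field of real numbers is an arbitrary [R : realType]. *)
From HB Require Import structures.
From mathcomp Require Import all_boot all_order all_algebra.
Set Implicit Arguments.
Unset Strict Implicit.
Unset Printing Implicit Defensive.
Import Order.TTheory GRing.Theory Num.Theory.
Local Open Scope ring_scope.

(* A digraph with vertex set V and arc set A is given by the maps [src] and
   [tgt]; distinct arcs may be parallel. *)
Section Digraphs.
Variables (V A : finType) (src tgt : A -> V).
Implicit Types U : {set V}.

Definition adjacent : rel V := fun v1 v2 =>
  [exists a, ((src a == v1) && (tgt a == v2)) ||
             ((src a == v2) && (tgt a == v1))].

Definition weakly_connected : Prop := forall v1 v2, connect adjacent v1 v2.

Definition arcs_out U : {set A} := [set a | (src a \in U) && (tgt a \notin U)].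

Definition arcs_in U : {set A} := [set a | (src a \notin U) && (tgt a \in U)].

End Digraphs.

Section Crossing.
Variable V : finType.

Definition crossing_family (C : {set {set V}}) : Prop :=
  forall U W, U \in C -> W \in C -> U :&: W != set0 -> U :|: W != setT ->
  (U :&: W \in C) && (U :|: W \in C).

(* [f] is a total function, but only its values on [C] matter. *)
Definition crossing_submodular (C : {set {set V}}) (f : {set V} -> int) : Prop :=
  forall U W, U \in C -> W \in C -> U :&: W != set0 -> U :|: W != setT ->
  f (U :&: W) + f (U :|: W) <= f U + f W.

End Crossing.

(* Imported only here because classical_sets shadows the names set0 and setT
   of finite sets used above. *)
From mathcomp Require Import boolp classical_sets reals.
Local Open Scope classical_set_scope.
Local Open Scope ring_scope.

Section Polyhedra.
Variables (R : realType) (J : finType).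
Implicit Types (c x : {ffun J -> R}) (P F : set {ffun J -> R}).

Definition dotp c x : R := \sum_j c j * x j.

Definition integral_point x : Prop := forall j, x j \is a Num.int.

(* A face is cut out by a valid inequality; [c = 0] and [d = 0] gives [P]
   itself. *)
Definition is_face P F : Prop :=
  exists c (d : R), (forall x, P x -> dotp c x <= d) /\
                    F = P `&` [set x | dotp c x = d].

Definition integral_polyhedron P : Prop :=
  forall F, is_face P F -> F !=set0 -> exists2 x, F x & integral_point x.

End Polyhedra.

(* The rational system B x <= b, with rows indexed by I and variables by J. *)
Section LinearSystems.
Variables (R : realType) (I J : finType) (B : I -> J -> rat) (b : I -> rat).
Implicit Types (w x : {ffun J -> R}) (u : {ffun I -> R}).

Definition solutions : set {ffun J -> R} :=
  [set x | forall i, \sum_j ratr (B i j) * x j <= ratr (b i)].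

Definition primal_optimal w x : Prop :=
  solutions x /\ forall x', solutions x' -> dotp w x' <= dotp w x.

(* The dual linear program: min { b^T u : B^T u = w, u >= 0 }. *)
Definition dual_feasible w u : Prop :=
  (forall i, 0 <= u i) /\ (forall j, \sum_i ratr (B i j) * u i = w j).

Definition dual_value u : R := \sum_i ratr (b i) * u i.

Definition dual_optimal w u : Prop :=
  dual_feasible w u /\
  forall u', dual_feasible w u' -> dual_value u <= dual_value u'.

Definition TDI : Prop :=
  forall w, integral_point w -> (exists x, primal_optimal w x) ->
  exists2 u, dual_optimal w u & integral_point u.

End LinearSystems.
Arguments solutions R {I J} B b.
Arguments TDI R {I J} B b.

Section CutSystem.
Variables (V A : finType) (src tgt : A -> V).
Variables (C : 'I_2 -> {set {set V}}) (f : 'I_2 -> {set V} -> int).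

(* One row for each pair (i, U) with U in C_i: a set lying in both families
   gives two rows. *)
Definition cut_row : finType := {r : 'I_2 * {set V} | r.2 \in C r.1}.

Definition cut_coef (r : cut_row) (a : A) : rat :=
  (a \in arcs_out src tgt (val r).2)%:R - (a \in arcs_in src tgt (val r).2)%:R.

Definition cut_rhs (r : cut_row) : rat := (f (val r).1 (val r).2)%:~R.

Definition cut_polyhedron (R : realType) : set {ffun A -> R} :=
  [set y | forall i U, U \in C i ->
     \sum_(a in arcs_out src tgt U) y a - \sum_(a in arcs_in src tgt U) y a
       <= (f i U)%:~R].

Lemma cut_polyhedronE (R : realType) :
  @cut_polyhedron R = solutions R cut_coef cut_rhs.
Proof.
have cutE (y : {ffun A -> R}) r : \sum_a ratr (cut_coef r a) * y a =
    \sum_(a in arcs_out src tgt (val r).2) y a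
    - \sum_(a in arcs_in src tgt (val r).2) y a.
  rewrite [X in _ = X - _]big_mkcond [X in _ = _ - X]big_mkcond -sumrB.
  apply: eq_bigr => a _; rewrite rmorphB /= !ratr_nat mulrBl.
  by do 2![case: (_ \in _)]; rewrite ?mul1r ?mul0r.
apply/seteqP; split=> y /= Py.
  by move=> r; rewrite cutE ratr_int; apply: Py; exact: (valP r).
move=> i U UC; have := Py (exist _ (i, U) UC : cut_row).
by rewrite cutE ratr_int.
Qed.

End CutSystem.
Arguments cut_row {V} C.
Arguments cut_coef {V A} src tgt {C} r a.
Arguments cut_rhs {V C} f r.
Arguments cut_polyhedron {V A} src tgt C f R.

(* Main.v *)
Require Import Defs.
From mathcomp Require Import all_boot all_order all_algebra.
From mathcomp Require Import boolp classical_sets reals.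
From mathcomp Require Import ring lra zify.
From mathcomp Require Import fintype finset.
Set Implicit Arguments.
Unset Strict Implicit.
Unset Printing Implicit Defensive.
Import Order.TTheory GRing.Theory Num.Theory.
Local Open Scope ring_scope.

(** Summing the coefficients of a set U over the arcs is a difference of
    potentials: the entry of row U at the arc a is [src a in U] - [tgt a in U].
    So a vector u of multipliers is dual feasible for w when the potentials
    z_i(v) = sum over U in C_i of u_{i,U} ([v in U] - [r in U]), for a fixed
    vertex r, satisfy (z_0 + z_1)(src a) - (z_0 + z_1)(tgt a) = w_a for every
    arc a. If w is integral, then so is z_0 + z_1, because it vanishes at r and
    the digraph is weakly connected ([potential_int]).

    Let x be a primal optimum. By Farkas' lemma w is a nonnegative rational
    combination of the rows tight at x ([optimum_tight_cone]). By
    submodularity, the tight sets of each C_i form a crossing family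
    ([tight_crossing_family]), in which the combination can be uncrossed until
    its support is cross-free, without changing the potentials ([uncross]).
    A combination with cross-free support can be rounded: replacing the sets
    that contain r by their complements makes the support laminar, and the
    multiplier of a set L becomes the difference between the potential of L
    and that of its parent in the laminar forest. Applying a nondecreasing
    function g with g 0 = 0 and integer values to all these potentials gives
    integral multipliers which have the right signs, whose support does not
    grow, and whose potential is g composed with the old one
    ([cross_free_rounding]). Taking the floor for i = 0 and the ceiling for
    i = 1 preserves the sum of the two potentials, since that sum is integral
    ([cut_cone_integral]). The rounded multipliers are thus dual feasible for w
    and still supported on rows tight at x, hence optimal by complementary
    slackness ([slackness]). This is total dual integrality.

    Integrality of the polyhedron follows by the argument of Edmonds and Giles
    ([TDI_integral_polyhedron]). A point x of a face with the most tight rows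
    has the property that every solution of the equations of these rows lies
    in the face. Such a system of equations has an integral solution unless
    some rational combination of the rows is integral with a nonintegral
    right-hand side ([kronecker], from the Smith normal form). A combination
    with integral row becomes nonnegative after adding a large integer to its
    coefficients; it is then a dual optimum for an integral objective, and
    total dual integrality makes its value an integer. *)

(** * Farkas' lemma and linear programming duality *)

(** The induction removes one generator i0, following Bartl. If w is
    nonpositive on the cone defined by the other generators, i0 gets the
    coefficient 0. Otherwise some x0 in that cone has w x0 > 0, hence
    a i0 x0 > 0, and projecting along x0 onto the hyperplane a i0 = 0 reduces
    the claim to the projected forms. *)
Lemma farkas (F : realFieldType) (I J : finType) (a : I -> J -> F)
    (w : J -> F) (s : seq I) :
  (forall x : J -> F, (forall i, i \in s -> \sum_j a i j * x j <= 0) ->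
     \sum_j w j * x j <= 0) ->
  exists u : I -> F, [/\ forall i, 0 <= u i, forall i, i \notin s -> u i = 0 &
     forall j, \sum_i a i j * u i = w j].
Proof.
elim: s a w => [|i0 s IHs] a w aw.
  exists (fun=> 0); split=> // j; rewrite big1; last by move=> i _; rewrite mulr0.
  have w2_le0 : \sum_j w j * w j <= 0 by apply: aw.
  have w2_ge0 k : 0 <= w k * w k by rewrite -expr2 sqr_ge0.
  have w2_eq0 : \sum_k w k * w k = 0.
    by apply/eqP; rewrite eq_le w2_le0 sumr_ge0.
  have /psumr_eq0P/(_ w2_eq0 j isT)/eqP : forall k, true -> 0 <= w k * w k by [].
  by rewrite mulf_eq0 orbb => /eqP.
have [aw_s|] := pselect (forall x : J -> F,
    (forall i, i \in s -> \sum_j a i j * x j <= 0) -> \sum_j w j * x j <= 0).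
  have [u [u_ge0 u_out uw]] := IHs a w aw_s; exists u; split=> // i.
  by rewrite inE negb_or => /andP[_ /u_out].
move=> /existsNP[x0 /not_implyP[x0s /negP]]; rewrite -ltNge => wx0.
pose v (c : J -> F) := \sum_j c j * x0 j.
have v0_gt0 : 0 < v (a i0).
  rewrite ltNge; apply/negP => v0_le0; move: wx0; rewrite ltNge => /negP; apply.
  by apply: aw => i; rewrite inE => /predU1P[->|/x0s].
pose k := (v (a i0))^-1.
have k_gt0 : 0 < k by rewrite invr_gt0.
(* pr c is the form c composed with the projection along x0 onto a i0 = 0. *)
pose pr (c : J -> F) j := c j - v c * k * a i0 j.
have prE (c x : J -> F) : \sum_j pr c j * x j =
    \sum_j c j * (x j - k * (\sum_j' a i0 j' * x j') * x0 j).
  rewrite /pr.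
  under eq_bigr do rewrite mulrBl.
  under [RHS]eq_bigr do rewrite mulrBr.
  rewrite !sumrB; congr (_ - _).
  under eq_bigr do rewrite -(mulrA (v c * k)).
  under [RHS]eq_bigr do rewrite mulrCA.
  by rewrite -!mulr_sumr /v; ring.
have [x ax|u [u_ge0 u_out uw]] := IHs (fun i => pr (a i)) (pr w).
  rewrite prE; apply: aw => i; rewrite inE => /predU1P[->|i_s]; last first.
    by rewrite -prE; exact: ax.
  under eq_bigr do rewrite mulrBr.
  rewrite sumrB; under [X in _ - X]eq_bigr do rewrite mulrCA.
  rewrite -mulr_sumr -/(v _) [k * _]mulrC -mulrA mulVf ?mulr1 ?subrr //.
  exact: lt0r_neq0.
(* The coefficient of a i0 that accounts for the projection; it is nonnegative
   because w x0 > 0 while the other generators are nonpositive at x0. *)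
pose kappa := k * (v w - \sum_i u i * v (a i)).
have kappa_ge0 : 0 <= kappa.
  apply: mulr_ge0; first exact: ltW.
  rewrite subr_ge0 (le_trans _ (ltW wx0))// -oppr_ge0 -sumrN; apply: sumr_ge0.
  move=> i _; have [i_s|/u_out->] := boolP (i \in s); last by rewrite mul0r oppr0.
  by rewrite oppr_ge0 mulr_ge0_le0 // x0s.
exists (fun i => u i + (i == i0)%:R * kappa); split=> [i|i|j].
- by rewrite addr_ge0 // mulr_ge0.
- by rewrite inE negb_or => /andP[/negPf-> /u_out->]; rewrite mul0r addr0.
under eq_bigr do rewrite mulrDr.
rewrite big_split /= [X in _ + X](bigD1 i0) //= eqxx mul1r.
rewrite [X in _ + (_ + X)]big1 ?addr0; last first.
  by move=> i /negPf->; rewrite mul0r mulr0.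
have := uw j; rewrite /pr /=.
under eq_bigr do rewrite mulrBl.
rewrite sumrB => /eqP; rewrite subr_eq => /eqP ->.
rewrite /kappa.
rewrite [X in _ + X + _](eq_bigr (fun i => k * a i0 j * (u i * v (a i)))).
  by rewrite -mulr_sumr; ring.
by move=> i _; ring.
Qed.

(** Moving from a feasible point along a ray, stop at the first inequality that
    becomes tight. Here p, q and b are the values of the left-hand sides at the
    point, at the direction, and the right-hand sides. *)
Lemma ray_exit (F : realFieldType) (I : finType) (p q b : I -> F) :
  (forall i, p i <= b i) -> (forall i, p i = b i -> q i <= 0) ->
  (forall t, 0 <= t -> forall i, p i + t * q i <= b i) \/
  exists t, [/\ 0 < t, forall i, p i + t * q i <= b i &
    exists2 i, p i < b i & p i + t * q i = b i].
Proof.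
move=> pb pq; have [[i1 qi1]|noq] := pselect (exists i, 0 < q i); last first.
  left=> t t_ge0 i; rewrite -[b i]addr0 lerD // mulr_ge0_le0 // leNgt.
  by apply/negP => qi; apply: noq; exists i.
right; have [i0 qi0 i0min] := @arg_minP _ _ _ i1 (fun i => 0 < q i)
  (fun i => (b i - p i) / q i) qi1.
have pi0 : p i0 < b i0.
  rewrite lt_neqAle pb andbT; apply/eqP => /pq; rewrite leNgt => /negP; exact.
exists ((b i0 - p i0) / q i0); split.
- by rewrite divr_gt0 // subr_gt0.
- move=> i; have [qi|qi] := ltP 0 (q i).
    by rewrite addrC -lerBrDr -ler_pdivlMr // i0min.
  by rewrite -[b i]addr0 lerD // mulr_ge0_le0 // divr_ge0 ?subr_ge0 // ltW.
by exists i0 => //; rewrite divfK ?gt_eqF // addrC subrK.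
Qed.

Section LinearProgramming.
Variables (R : realType) (I J : finType) (B : I -> J -> rat) (b : I -> rat).
Implicit Types (w x d : {ffun J -> R}) (u : {ffun I -> R}).

Definition lhs x i : R := \sum_j ratr (B i j) * x j.

Definition tight x i : bool := lhs x i == ratr (b i).

Definition ray x (t : R) d : {ffun J -> R} := [ffun j => x j + t * d j].

Lemma dotp_ray w x t d : dotp w (ray x t d) = dotp w x + t * dotp w d.
Proof.
rewrite /dotp mulr_sumr -big_split; apply: eq_bigr => j _ /=.
by rewrite ffunE mulrDr mulrCA.
Qed.

Lemma lhs_ray x t d i : lhs (ray x t d) i = lhs x i + t * lhs d i.
Proof.
have lhsE y : lhs y i = dotp [ffun j => ratr (B i j)] y.
  by apply: eq_bigr => j _; rewrite ffunE.
by rewrite !lhsE dotp_ray.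
Qed.

Lemma solutions_ray x d : solutions R B b x ->
    (forall i, tight x i -> lhs d i <= 0) ->
  (forall t, 0 <= t -> solutions R B b (ray x t d)) \/
  exists t, [/\ 0 < t, solutions R B b (ray x t d) &
    exists2 i, ~~ tight x i & tight (ray x t d) i].
Proof.
move=> Px dT.
have [|ray_in|[t [t_gt0 Pt [i xi ti]]]] :=
  @ray_exit _ _ (lhs x) (lhs d) (fun i => ratr (b i)) Px.
- by move=> i /eqP; exact: dT.
- by left=> t t_ge0 i; rewrite -/(lhs _ i) lhs_ray; exact: ray_in.
right; exists t; split=> //.
  by move=> i'; rewrite -/(lhs _ i') lhs_ray; exact: Pt.
by exists i; rewrite /tight ?lhs_ray ?ti // lt_eqF.
Qed.

Lemma dual_gap w x u : dual_feasible B w u ->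
  dual_value b u - dotp w x = \sum_i (ratr (b i) - lhs x i) * u i.
Proof.
move=> [_ uw]; rewrite /dual_value /dotp.
under [X in _ - X]eq_bigr do rewrite -uw mulr_suml.
rewrite exchange_big /= -sumrB; apply: eq_bigr => i _.
rewrite mulrBl /lhs mulr_suml; congr (_ - _); apply: eq_bigr => j _; ring.
Qed.

Lemma weak_duality w x u : solutions R B b x -> dual_feasible B w u ->
  dotp w x <= dual_value b u.
Proof.
move=> Px Du; rewrite -subr_ge0 (dual_gap _ Du); apply: sumr_ge0 => i _.
by rewrite mulr_ge0 ?(proj1 Du) // subr_ge0; exact: Px.
Qed.

Lemma slackness w x u : solutions R B b x -> dual_feasible B w u ->
    (forall i, u i != 0 -> tight x i) ->
  dual_value b u = dotp w x /\ primal_optimal B b w x /\ dual_optimal B b w u.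
Proof.
move=> Px Du xu; have uwx : dual_value b u = dotp w x.
  apply/eqP; rewrite -subr_eq0 (dual_gap _ Du) big1 // => i _.
  have [->|/xu/eqP->] := eqVneq (u i) 0; first by rewrite mulr0.
  by rewrite subrr mul0r.
split=> //; split; split=> //.
  by move=> x' Px'; rewrite -uwx; exact: weak_duality.
by move=> u' Du'; rewrite uwx; exact: weak_duality.
Qed.

(** The multipliers can be taken rational although x is real: the tight rows and
    the objective c are rational, so that Farkas' lemma over the rationals
    would otherwise give a rational direction that improves on x. *)
Lemma optimum_tight_cone (c : J -> rat) x :
  primal_optimal B b [ffun j => ratr (c j)] x ->
  exists u : I -> rat, [/\ forall i, 0 <= u i, forall i, u i != 0 -> tight x i &
    forall j, \sum_i B i j * u i = c j].
Proof.
move=> [Px xopt].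
have [d dT|u [u_ge0 u_out uc]] := @farkas rat I J B c (enum (tight x)).
  rewrite leNgt; apply/negP => cd.
  pose d' : {ffun J -> R} := [ffun j => ratr (d j)].
  have lhsd i : lhs d' i = ratr (\sum_j B i j * d j).
    by rewrite rmorph_sum; apply: eq_bigr => j _; rewrite ffunE rmorphM.
  have dotd : dotp [ffun j => ratr (c j)] d' = ratr (\sum_j c j * d j).
    by rewrite rmorph_sum; apply: eq_bigr => j _; rewrite !ffunE rmorphM.
  have [t t_gt0 Pt] : exists2 t, 0 < t & solutions R B b (ray x t d').
    have [|ray_in|[t [t_gt0 Pt _]]] := @solutions_ray x d' Px; last by exists t.
      by move=> i xi; rewrite lhsd lerq0 dT // mem_enum.
    by exists 1 => //; exact: ray_in.
  have := xopt _ Pt; rewrite dotp_ray dotd gerDl leNgt.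
  by rewrite mulr_gt0 // ltr0q.
exists u; split=> // i; apply: contraNT => xi; apply/eqP/u_out.
by rewrite mem_enum.
Qed.

End LinearProgramming.

(** * Integral solutions of linear equations *)

(** In Smith normal form the system becomes diagonal, with entries e i, and the
    hypothesis applied to suitable multiples t of the rows of the inverse of L
    says that t * b' i is integral whenever t * e i is. The choice t = 1 / e i
    gives the divisibility that is needed, and if e i = 0 the choice
    t = 1 / (2 * b' i) excludes b' i <> 0. *)
Lemma kronecker_mx m n (M : 'M[int]_(m, n)) (b : 'cV[int]_m) :
  (forall l : 'rV[rat]_m, (forall j, (l *m map_mx intr M) 0 j \is a Num.int) ->
     (l *m map_mx intr b) 0 0 \is a Num.int) ->
  exists y : 'cV[int]_n, M *m y = b.
Proof.
case: (int_Smith_normal_form M) => L uL [K uK [d _ ->]] Mb.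
set D := (\matrix_(i, j) _) in Mb *.
pose b' := invmx L *m b.
(* The diagonal of D, extended by 0 when D has more rows than columns. *)
pose e (i : 'I_m) := if (i < n)%N then d`_i else 0.
have DE i j : D i j = e i *+ (i == j :> nat).
  by rewrite mxE /e; case: eqP => // ->; rewrite ltn_ord.
have te_b' (t : rat) i : t * (e i)%:~R \is a Num.int ->
    t * (b' i 0)%:~R \is a Num.int.
  move=> te.
  pose l : 'rV[rat]_m := t *: map_mx intr (row i (invmx L)).
  have lN p (N : 'M[int]_(m, p)) j :
      (l *m map_mx intr N) 0 j = t * ((invmx L *m N) i j)%:~R.
    by rewrite /l -scalemxAl -map_mxM -row_mul !mxE.
  rewrite -lN; apply: Mb => j; rewrite lN !mulmxA mulVmx // mul1mx mxE.
  rewrite rmorph_sum mulr_sumr; apply: rpred_sum => k _.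
  rewrite DE rmorphM mulrA; apply: rpredM; last exact: intr_int.
  by case: eqP => _; rewrite ?mulr0n ?mulr1n ?mulr0.
have e_dvd i : (e i %| b' i ord0)%Z.
  have [e0|e_neq0] := eqVneq (e i) 0; last first.
    have : (e i)%:~R^-1 * (e i)%:~R \is a @Num.int rat by rewrite mulVf ?intr_eq0.
    move=> /te_b'/intrP[q qE]; apply/dvdzP; exists q.
    apply: (@intr_inj rat); rewrite rmorphM /= -qE mulrC mulrA divff ?mul1r //.
    by rewrite intr_eq0.
  rewrite e0 dvd0z; apply/negPn/negP => b_neq0.
  have := te_b' (2 * (b' i 0)%:~R)^-1 i; rewrite e0 mulr0 => /(_ (intr_int _ 0)).
  by rewrite invfM -mulrA mulVf ?intr_eq0 // mulr1.
pose y' : 'cV[int]_n :=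
  \col_j (if insub (val j) is Some i then (b' i ord0 %/ e i)%Z else 0).
exists (invmx K *m y').
rewrite -mulmxA mulKVmx // -mulmxA (_ : D *m y' = b') ?mulKVmx //.
apply/matrixP => i j; rewrite ord1 mxE.
have [lt_in|le_ni] := ltnP i n.
  rewrite (bigD1 (Ordinal lt_in)) //= big1 ?addr0.
    rewrite DE /= eqxx mulr1n mxE /= insubT //= => lt_im.
    rewrite (_ : Sub _ _ = i); last exact: val_inj.
    by rewrite mulrC divzK.
  move=> k /eqP kn; rewrite DE; case: eqP => [ik|_]; last by rewrite mul0r.
  by case: kn; apply: val_inj.
rewrite big1; last first.
  by move=> k _; rewrite DE gtn_eqF ?mul0r // (leq_trans _ le_ni).
have := e_dvd i; rewrite /e ltnNge le_ni /= dvd0z => /eqP.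
by move->.
Qed.

Lemma kronecker (I J : finType) (B : I -> J -> int) (b : I -> int) :
  (forall l : I -> rat,
     (forall j, \sum_i l i * (B i j)%:~R \is a Num.int) ->
     \sum_i l i * (b i)%:~R \is a Num.int) ->
  exists y : J -> int, forall i, \sum_j B i j * y j = b i.
Proof.
move=> Bb.
pose M := \matrix_(i < #|I|, j < #|J|) B (enum_val i) (enum_val j).
pose c := \col_(i < #|I|) b (enum_val i).
have reindexI (T : nmodType) (G : I -> T) :
    \sum_i G i = \sum_(k < #|I|) G (enum_val k).
  by rewrite (reindex _ (onW_bij _ (@enum_val_bij I))).
have [l lM|y /matrixP My] := @kronecker_mx _ _ M c.
  have := Bb (fun i => l 0 (enum_rank i)).
  rewrite mxE (reindexI _ (fun i => l 0 (enum_rank i) * (b i)%:~R)).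
  under eq_bigr do rewrite enum_valK.
  under [X in _ -> X \is a _]eq_bigr do rewrite !mxE.
  apply=> j; rewrite (reindexI _ (fun i => l 0 (enum_rank i) * (B i j)%:~R)).
  have := lM (enum_rank j); rewrite mxE.
  under eq_bigr do rewrite !mxE enum_rankK.
  by under [X in _ -> X \is a _]eq_bigr do rewrite enum_valK.
exists (fun j => y (enum_rank j) 0) => i.
have := My (enum_rank i) 0; rewrite !mxE enum_rankK => <-.
rewrite (reindex _ (onW_bij _ (@enum_val_bij J))).
by apply: eq_bigr => k _; rewrite mxE enum_rankK enum_valK.
Qed.

(** * Total dual integrality implies integral faces *)

Section IntegralFaces.
Variables (R : realType) (I J : finType) (B : I -> J -> int) (b : I -> int).
Let BQ i j : rat := (B i j)%:~R.
Let bQ i : rat := (b i)%:~R.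

(** Given a combination l of the tight rows with integral row, l + N for a large
    integer N is a dual optimum u for an integral objective w, x being a primal
    optimum. An integral dual optimum has the same value, so the right-hand
    side of the combination u, hence that of l, is integral. *)
Lemma TDI_tight_integral x : TDI R BQ bQ -> solutions R BQ bQ x ->
  exists y : J -> int, forall i, tight BQ bQ x i -> \sum_j B i j * y j = b i.
Proof.
move=> tdi Px; pose T := tight BQ bQ x.
pose BT i j := if T i then B i j else 0.
pose bT i := if T i then b i else 0.
have [l lB|y By] := @kronecker _ _ BT bT; last first.
  exists y => i Ti; have := By i; rewrite /BT /bT /T Ti //.
(* Any integer bounding all the entries of l in absolute value will do. *)
have [N lN] : exists N : nat, forall i, 0 <= l i + N%:R.
  exists (\sum_i Num.bound `|l i|)%N => i.
  have l_lt := archi_boundP (normr_ge0 (l i)).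
  have := ler_norm (- l i); rewrite normrN => Nl_le.
  have : (Num.bound `|l i|)%:R <= (\sum_i Num.bound `|l i|)%:R :> rat.
    by rewrite ler_nat (bigD1 i) //= leq_addr.
  by lra.
pose u := [ffun i => if T i then ratr (l i + N%:R) else 0 : R].
pose w := [ffun j => \sum_i ratr (BQ i j) * u i].
have Du : dual_feasible BQ w u.
  split=> [i|j]; last by rewrite ffunE.
  by rewrite ffunE; case: ifP => // _; rewrite ler0q.
have [|uwx [xopt _]] := slackness Px Du.
  by move=> i; rewrite ffunE /T; case: ifP => //; rewrite eqxx.
(* For integer data c, the combinations given by u and by l thus differ by an
   integer multiple of N. *)
have uE (c : I -> int) : \sum_i ratr (c i)%:~R * u i =
    ratr (\sum_i l i * (if T i then c i else 0)%:~R +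
          N%:R * (\sum_i if T i then c i else 0)%:~R).
  rewrite rmorph_sum mulr_sumr -big_split rmorph_sum; apply: eq_bigr => i _ /=.
  rewrite ffunE; case: ifP => _; last by rewrite !mulr0 addr0 rmorph0.
  by rewrite -mulrDl mulrC rmorphM.
have ratr_int_num (q : rat) : (ratr q : R) \is a Num.int = (q \is a Num.int).
  apply/intrP/intrP => [][m]; last by move->; exists m; rewrite ratr_int.
  by rewrite -(ratr_int _ m) => /fmorph_inj ->; exists m.
have wint : integral_point w.
  move=> j; rewrite ffunE uE ratr_int_num rpredD ?rpredM ?natr_int ?intr_int //.
  exact: lB.
have [v [Dv vopt] vint] := tdi w wint (ex_intro _ x xopt).
have vu : dual_value bQ v = dual_value bQ u.
  by apply/eqP; rewrite eq_le vopt // uwx; exact: weak_duality.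
have : dual_value bQ u \is a Num.int.
  by rewrite -vu; apply: rpred_sum => i _; rewrite rpredM // ratr_int intr_int.
by rewrite /dual_value uE ratr_int_num rpredDr // rpredM ?natr_int ?intr_int.
Qed.

(** Take a point x of the face F with the most tight rows and an integral
    solution y of the equations of these rows. The segment from x to y stays in F, for at
    the first point where it left the polyhedron a further row would be tight.
    The objective c is constant along it, because both y - x and its opposite
    are feasible directions at x. *)
Lemma TDI_integral_polyhedron :
  TDI R BQ bQ -> integral_polyhedron (solutions R BQ bQ).
Proof.
move=> tdi F [c [d [cd FE]]] [x0 Fx0].
have FP x : F x <-> solutions R BQ bQ x /\ dotp c x = d by rewrite FE.
have [x [Fx xmax]] : exists x, F x /\ forall x', F x' ->
    (#|tight BQ bQ x'| <= #|tight BQ bQ x|)%N.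
  have exF : exists n, `[<exists2 x, F x & #|tight BQ bQ x| = n>].
    by exists #|tight BQ bQ x0|; apply/asboolP; exists x0.
  have ubF n : `[<exists2 x, F x & #|tight BQ bQ x| = n>] -> (n <= #|I|)%N.
    by move=> /asboolP[x _ <-]; exact: max_card.
  case: (ex_maxnP exF ubF) => n /asboolP[x Fx <-] xmax; exists x; split=> // x' Fx'.
  by apply: xmax; apply/asboolP; exists x'.
have [Px cx] := (FP x).1 Fx.
have [y By] := TDI_tight_integral tdi Px.
pose e := [ffun j => (y j)%:~R - x j].
have e_tight i : tight BQ bQ x i -> lhs BQ e i = 0.
  move=> xi; rewrite /lhs; under eq_bigr do rewrite ffunE mulrBr.
  rewrite sumrB -/(lhs BQ x i) (eqP xi) /bQ -(By i xi) ratr_int rmorph_sum.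
  apply/eqP; rewrite subr_eq0; apply/eqP; apply: eq_bigr => j _.
  by rewrite ratr_int rmorphM.
have ce_le0 e' : (forall i, tight BQ bQ x i -> lhs BQ e' i = 0) -> dotp c e' <= 0.
  move=> e'T.
  have [t t_gt0 Pt] : exists2 t, 0 < t & solutions R BQ bQ (ray x t e').
    have [|ray_in|[t [t_gt0 Pt _]]] := solutions_ray (d := e') Px; last by exists t.
      by move=> i /e'T->.
    by exists 1 => //; exact: ray_in.
  by have := cd _ Pt; rewrite dotp_ray cx gerDl pmulr_rle0.
(* That is, - e. *)
pose e_opp := ray e (- 2) e.
have ce0 : dotp c e = 0.
  apply/eqP; rewrite eq_le ce_le0 //=.
  have /ce_le0 : forall i, tight BQ bQ x i -> lhs BQ e_opp i = 0.
    by move=> i xi; rewrite lhs_ray e_tight // mulr0 addr0.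
  by rewrite dotp_ray; lra.
exists [ffun j => (y j)%:~R]; last by move=> j; rewrite ffunE intr_int.
have -> : [ffun j => (y j)%:~R] = ray x 1 e.
  by apply/ffunP => j; rewrite !ffunE mul1r addrC subrK.
apply/FP; split; last by rewrite dotp_ray ce0 mulr0 addr0.
have [|ray_in|[t [t_gt0 Pt [i xi ti]]]] := solutions_ray (d := e) Px.
- by move=> i /e_tight->.
- exact: ray_in.
have Ft : F (ray x t e) by apply/FP; rewrite dotp_ray ce0 mulr0 addr0.
have := xmax _ Ft; rewrite leqNgt => /negP[]; apply: proper_card.
apply/properP; split; last by exists i.
apply/fintype.subsetP => i' xi'; rewrite !unfold_in.
by rewrite /tight lhs_ray (e_tight _ xi') mulr0 addr0.
Qed.

End IntegralFaces.

(** * Uncrossing *)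

Section Uncrossing.
Variable V : finType.
Implicit Types (U W L M X : {set V}) (s : seq {set V}).

(** Crossing in the symmetric sense: all four cells of the partition generated by
    U and W are nonempty. This is invariant under complementing one of the
    sets, which is what makes rooting a cross-free family possible. *)
Definition crossing U W : bool :=
  [&& U :&: W != set0, U :|: W != setT, ~~ (U \subset W) & ~~ (W \subset U)].

Lemma crossing_sym U W : crossing U W = crossing W U.
Proof. by rewrite /crossing setIC setUC; congr [&& _, _ & _]; rewrite andbC. Qed.

Lemma setU_eqT U W : (U :|: W == setT) = (~: W \subset U).
Proof. by rewrite -(inj_eq (@setC_inj _)) setCT setCU -setD_eq0 setDE setIC. Qed.

Lemma crossingCr U W : crossing U (~: W) = crossing U W.
Proof.
rewrite /crossing !setU_eqT setCK -setDE setD_eq0 -disjoints_subset -setI_eq0.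
by case: (U \subset W) (W \subset U) (~: W \subset U) => [] [] [];
   rewrite ?andbF ?andbT.
Qed.

(** With a, b, c, d the sizes of U minus W, W minus U, the intersection and the
    complement of the union, the right-hand side exceeds the left by 2ab. *)
Lemma uncrossing_potential U W : crossing U W ->
  (#|U :&: W| * #|~: (U :&: W)| + #|U :|: W| * #|~: (U :|: W)| <
   #|U| * #|~: U| + #|W| * #|~: W|)%N.
Proof.
move=> /and4P[_ _ UW WU].
have := cardsC U; have := cardsC W; have := cardsC (U :&: W).
have := cardsC (U :|: W); have := cardsUI U W.
have := cardsID W U; have := cardsID U W; rewrite [W :&: U]setIC.
move: UW WU; rewrite -!setD_eq0 -!card_gt0.
nia.
Qed.

(** Multiplicities are represented by repetitions in a sequence, so that one
    uncrossing step replaces two entries U and W by their intersection and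
    union; the potential above bounds the number of steps. *)
Lemma uncross_seq (T : {set {set V}}) s : crossing_family T ->
    {subset s <= T} ->
  exists s', [/\ {subset s' <= T}, {in s' &, forall U W, ~~ crossing U W} &
    forall v, (\sum_(U <- s') (v \in U) = \sum_(U <- s) (v \in U))%N].
Proof.
move=> Tcross; have [k] := ubnP (\sum_(U <- s) #|U| * #|~: U|)%N.
elim: k s => // k IHk s ltk sT.
have [[U [W [Us Ws UW]]]|noUW] :=
    pselect (exists U W, [/\ U \in s, W \in s & crossing U W]); last first.
  exists s; split=> // U W Us Ws; apply/negP => UW; apply: noUW.
  by exists U, W.
have WneU : W != U by apply: contraTneq UW => ->; rewrite /crossing subxx !andbF.
pose s0 := rem W (rem U s).
have s_perm : perm_eq s [:: U, W & s0].
  rewrite (perm_trans (perm_to_rem Us)) // perm_cons perm_to_rem //.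
  by move: Ws; rewrite (perm_mem (perm_to_rem Us)) inE (negPf WneU).
have s0T : {subset s0 <= T} by move=> X /mem_rem/mem_rem/sT.
have [UIW UUW _ _] := and4P UW.
have /andP[TI TU] := Tcross _ _ (sT _ Us) (sT _ Ws) UIW UUW.
have [||s' [s'T s'cf s'v]] := IHk [:: U :&: W, U :|: W & s0].
- move: ltk; rewrite (perm_big _ s_perm) /= !big_cons.
  have := uncrossing_potential UW; lia.
- by move=> X; rewrite !inE => /or3P[/eqP->|/eqP->|/s0T].
exists s'; split=> // v; rewrite s'v (perm_big _ s_perm) /= !big_cons inE inE.
by case: (v \in U); case: (v \in W).
Qed.

End Uncrossing.

(** * Rounding combinations with cross-free support *)

Section Rounding.
Variable V : finType.
Implicit Types (U W L M X : {set V}).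

(** The sum telescopes along the chain S: the inner sums of a set over its
    supersets and over its proper supersets are consecutive partial sums of
    c, counted from the largest set. *)
Lemma sum_chain (S : {set {set V}}) (c : {set V} -> rat) (g : rat -> int) :
    {in S &, forall L M, (L \subset M) || (M \subset L)} ->
  \sum_(L in S) (g (\sum_(M in S | L \subset M) c M) -
                 g (\sum_(M in S | L \proper M) c M)) =
  g (\sum_(L in S) c L) - g 0.
Proof.
have [k] := ubnP #|S|; elim: k S => // k IHk S ltSk chain.
have [->|[L0' SL0']] := set_0Vmem S; first by rewrite !big_set0 subrr.
have [L0 SL0 L0min] := arg_minnP (fun L => #|L|) SL0'; have {}SL0 : L0 \in S by [].
have L0sub L : L \in S -> L0 \subset L.
  move=> SL; have /orP[//|LL0] := chain _ _ SL0 SL.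
  by have /eqP -> : L == L0 by rewrite eqEcard LL0 L0min.
have S'E L : (L \in S :\ L0) = (L \in S) && (L0 \proper L).
  rewrite !inE properEneq andbC eq_sym; case SL: (L \in S) => //=.
  by rewrite L0sub // andbT.
rewrite (bigD1 L0) //= [RHS](_ : _ = (g (\sum_(L in S) c L) -
   g (\sum_(L in S :\ L0) c L)) + (g (\sum_(L in S :\ L0) c L) - g 0)); last first.
  by rewrite addrA subrK.
congr (_ - g _ + _).
- congr g; apply: eq_bigl => M; case SM: (M \in S) => //=; exact: L0sub.
- by apply: eq_bigl => M; rewrite S'E.
rewrite -IHk; first last.
- by move=> L M; rewrite !inE => /andP[_ SL] /andP[_ SM]; exact: chain.
- by move: ltSk; rewrite [#|S|](cardsD1 L0) SL0.
apply: eq_big => [L|L /andP[SL LL0]]; first by rewrite !inE andbC.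
congr (g _ - g _); apply: eq_bigl => M; rewrite !inE;
  case: eqVneq => //= ->; rewrite SL0 /=; apply/negP.
  move=> LL; case/negP: LL0; rewrite eqEsubset LL; exact: L0sub.
by move=> /proper_sub LL; case/negP: LL0; rewrite eqEsubset LL; exact: L0sub.
Qed.

(** The difference between v and r of the potential of the combination m. *)
Definition cut_sum (F : pzRingType) (m : {set V} -> F) (v r : V) : F :=
  \sum_U m U * ((v \in U)%:R - (r \in U)%:R).

(** Complementing the sets that contain the root r changes the sign of their
    contribution, so only sets avoiding r remain. *)
Lemma cut_sum_avoiding (F : pzRingType) (m : {set V} -> F) v r :
  cut_sum m v r = \sum_(L : {set V} | (r \notin L) && (v \in L)) (m L - m (~: L)).
Proof.
rewrite /cut_sum (bigID (fun U => r \in U)) /= addrC.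
rewrite [X in _ + X](reindex_inj (@setC_inj V)) /=.
under [X in _ + X]eq_bigl do rewrite in_setC.
rewrite -big_split /= [RHS]big_mkcondr; apply: eq_bigr => L rL.
rewrite !in_setC (negPf rL); case: (v \in L) => /=.
  by rewrite subr0 mulr1 sub0r mulrN1.
by rewrite !subrr !mulr0 addr0.
Qed.

(** On sets L avoiding r the multiplier is c L. The sets with c L <> 0 that
    contain a given vertex v form a chain, as m has cross-free support, and
    P L, P' L are the potentials of L and of its parent. The new multiplier
    g (P L) - g (P' L) is zero or has the sign of c L because g is
    nondecreasing; its positive part goes to L and its negative part to the complement of L. *)
Lemma cross_free_rounding (r : V) (m : {set V} -> rat) (g : rat -> int) :
    (forall U, 0 <= m U) ->
    (forall U W, m U != 0 -> m W != 0 -> ~~ crossing U W) ->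
    {homo g : x y / x <= y} -> g 0 = 0 ->
  exists n : {set V} -> int, [/\ forall U, 0 <= n U,
    forall U, n U != 0 -> m U != 0 &
    forall v, cut_sum n v r = g (cut_sum m v r)].
Proof.
move=> m_ge0 m_cf g_homo g0.
pose c L := m L - m (~: L).
pose P L := \sum_(M : {set V} | (r \notin M) && (L \subset M)) c M.
pose P' L := \sum_(M : {set V} | (r \notin M) && (L \proper M)) c M.
have PE L : r \notin L -> P L = c L + P' L.
  move=> rL; rewrite /P (bigD1 L) /=; last by rewrite rL subxx.
  congr (_ + _); apply: eq_bigl => M; rewrite properEneq eq_sym.
  by rewrite -andbA [(_ \subset _) && _]andbC.
pose d L := g (P L) - g (P' L).
have d_gt0 L : r \notin L -> 0 < d L -> 0 < c L.
  move=> rL; rewrite subr_gt0 ltNge => gP; rewrite ltNge; apply: contra gP => cL.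
  by apply: g_homo; rewrite PE // gerDr.
have d_lt0 L : r \notin L -> d L < 0 -> c L < 0.
  move=> rL; rewrite subr_lt0 ltNge => gP; rewrite ltNge; apply: contra gP => cL.
  by apply: g_homo; rewrite PE // lerDr.
pose n U := if r \in U then Num.max 0 (- d (~: U)) else Num.max 0 (d U).
have n_supp U : n U != 0 -> m U != 0.
  move=> nU; apply: lt0r_neq0; move: nU; rewrite /n; case: ifPn => rU nU.
    have rCU : r \notin ~: U by rewrite in_setC rU.
    have /(d_lt0 _ rCU) : d (~: U) < 0.
      by rewrite ltNge -oppr_le0; apply: contraNN nU => dU; rewrite max_l.
    by rewrite /c setCK subr_lt0; apply: le_lt_trans.
  have /(d_gt0 _ rU) : 0 < d U.
    by rewrite ltNge; apply: contraNN nU => dU; rewrite max_l.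
  by rewrite subr_gt0; apply: le_lt_trans.
exists n; split=> // [U|v]; first by rewrite /n; case: ifP; rewrite le_max lexx.
pose S := [set L : {set V} | [&& r \notin L, v \in L & c L != 0]].
have S_chain : {in S &, forall L M, (L \subset M) || (M \subset L)}.
  have c_supp L : c L != 0 -> exists2 U, m U != 0 & U = L \/ U = ~: L.
    move=> cL; have [mL|] := eqVneq (m L) 0; last by exists L => //; left.
    exists (~: L); last by right.
    by apply: contraNneq cL => mCL; rewrite /c mL mCL subrr.
  move=> L M; rewrite !inE => /and3P[rL vL /c_supp[U mU UL]].
  move=> /and3P[rM vM /c_supp[W mW WM]].
  have : ~~ crossing L M.
    have := m_cf _ _ mU mW; case: UL => ->; case: WM => -> //;
    by rewrite ?crossingCr // crossing_sym ?crossingCr // crossing_sym.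
  rewrite /crossing; case: (L \subset M) => //=; case: (M \subset L) => //=.
  rewrite !andbT => /negP[]; apply/andP; split.
    by apply/set0Pn; exists v; rewrite inE vL.
  by apply/eqP => /setP/(_ r); rewrite !inE (negPf rL) (negPf rM).
have SE (Q : {set V} -> bool) : (forall M, Q M -> v \in M) ->
    \sum_(M : {set V} | (r \notin M) && Q M) c M = \sum_(M in S | Q M) c M.
  move=> Qv; rewrite [RHS]big_mkcond [LHS]big_mkcond; apply: eq_bigr => M _.
  rewrite inE; case: (boolP (Q M)) => [/Qv->|]; rewrite ?andbF // !andbT.
  by case: (r \notin M) => //=; case: eqP.
rewrite !cut_sum_avoiding (SE (fun M => v \in M)) // -/c.
have -> : \sum_(M in S | v \in M) c M = \sum_(M in S) c M.
  by apply: eq_bigl => M; rewrite inE; case: (v \in M); rewrite ?andbF ?andbT.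
rewrite -[RHS]subr0 -[in RHS]g0 -(sum_chain _ _ S_chain).
rewrite [RHS]big_mkcond [LHS]big_mkcond; apply: eq_bigr => L _.
rewrite inE; case: (boolP (r \in L)) => //= rL; case: (boolP (v \in L)) => //= vL.
have nd : n L - n (~: L) = d L.
  rewrite /n in_setC rL (negPf rL) setCK; case: (leP (d L) 0) => dL.
    by rewrite max_r ?oppr_ge0 // sub0r opprK.
  by rewrite max_l ?subr0 // oppr_le0 ltW.
rewrite nd; case: eqVneq => [cL|_].
  by rewrite /d PE // cL add0r subrr.
by congr (g _ - g _); rewrite -SE // => M; last move=> /proper_sub;
   move=> /subsetP; exact.
Qed.
End Rounding.

(** * Integral combinations of the cuts of two crossing families *)

Section CutCones.
Variable V : finType.
Implicit Types (U W : {set V}).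

Lemma common_denominator (I : finType) (q : I -> rat) : (forall i, 0 <= q i) ->
  exists N (n : I -> nat), (0 < N)%N /\ forall i, q i = (n i)%:R / N%:R.
Proof.
move=> q_ge0; pose N := (\prod_i `|denq (q i)|)%N.
have N_gt0 : (0 < N)%N by rewrite prodn_gt0 // => i; rewrite absz_gt0 denq_neq0.
exists N, (fun i => `|numq (q i)| * \prod_(j | j != i) `|denq (q j)|)%N.
split=> // i; rewrite [N](bigD1 i) //= !natrM invfM.
have others_neq0 : (\prod_(j | j != i) `|denq (q j)|)%N%:R != 0 :> rat.
  by rewrite pnatr_eq0 -lt0n prodn_gt0 // => j; rewrite absz_gt0 denq_neq0.
rewrite [_^-1 * _]mulrC mulrA mulfK // -{1}[q i]divq_num_den.
rewrite !pmulrn gez0_abs ?numq_ge0 // gez0_abs //; exact/ltW/denq_gt0.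
Qed.

(** Rational multipliers are scaled to multiplicities, so that uncrossing
    terminates. *)
Lemma uncross (T : {set {set V}}) (m : {set V} -> rat) :
    crossing_family T -> (forall U, 0 <= m U) -> (forall U, m U != 0 -> U \in T) ->
  exists m' : {set V} -> rat, [/\ forall U, 0 <= m' U,
    forall U, m' U != 0 -> U \in T,
    forall U W, m' U != 0 -> m' W != 0 -> ~~ crossing U W &
    forall v, \sum_U m' U * (v \in U)%:R = \sum_U m U * (v \in U)%:R].
Proof.
move=> Tcross m_ge0 mT.
have [N [n [N_gt0 mE]]] := common_denominator m_ge0.
pose s := flatten [seq nseq (n U) U | U <- enum {set V}].
have NV0 : N%:R^-1 != 0 :> rat by rewrite invr_eq0 pnatr_eq0 -lt0n.
have s_sum v : (\sum_(U <- s) (v \in U) = \sum_U n U * (v \in U))%N.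
  rewrite big_flatten big_map big_enum; apply: eq_bigr => U _.
  by rewrite big_nseq iter_addn_0 mulnC.
have count_sum (s0 : seq {set V}) v :
    (\sum_(U <- s0) (v \in U) = \sum_U count_mem U s0 * (v \in U))%N.
  elim: s0 => [|X s0 IHs]; first by rewrite big_nil big1.
  rewrite big_cons IHs /= (bigD1 X) //= [RHS](bigD1 X) //= eqxx mulnDl mul1n -addnA.
  congr (_ + (_ + _))%N; apply: eq_bigr => U UX.
  by rewrite eq_sym (negPf UX).
have sT : {subset s <= T}.
  move=> U /flattenP[_ /mapP[W _ ->]]; rewrite mem_nseq => /andP[nW /eqP->].
  by apply: mT; rewrite mE mulf_neq0 // pnatr_eq0 -lt0n.
have [s' [s'T s'cf s'v]] := uncross_seq Tcross sT.
have supp U : (count_mem U s')%:R / N%:R != 0 :> rat -> U \in s'.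
  by apply: contraNT => /count_memPn ->; rewrite mul0r.
exists (fun U => (count_mem U s')%:R / N%:R); split=> [U|U /supp/s'T//|U W|v].
- by rewrite divr_ge0.
- by move=> /supp Us /supp Ws; exact: s'cf.
have natE (c : {set V} -> nat) : \sum_U (c U)%:R / N%:R * (v \in U)%:R =
    (\sum_U c U * (v \in U))%N%:R / N%:R :> rat.
  rewrite natr_sum mulr_suml; apply: eq_bigr => U _; rewrite natrM; ring.
by rewrite natE -count_sum s'v s_sum -natE; apply: eq_bigr => U _; rewrite mE.
Qed.

Variables (A : finType) (src tgt : A -> V).

Lemma cut_sum_chasles (F : pzRingType) (m : {set V} -> F) v1 v2 r :
  cut_sum m v1 v2 = cut_sum m v1 r - cut_sum m v2 r.
Proof.
rewrite /cut_sum -sumrB; apply: eq_bigr => U _.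
by rewrite -mulrBr opprB addrA subrK.
Qed.

Lemma potential_int (z : V -> rat) r : weakly_connected src tgt ->
    z r \is a Num.int -> (forall a, z (src a) - z (tgt a) \is a Num.int) ->
  forall v, z v \is a Num.int.
Proof.
move=> conn zr za v; have /connectP[p] := conn r v.
elim: p r zr => [|v' p IHp] r zr /=; first by move=> _ ->.
move=> /andP[/existsP[a rv'] pathp]; apply: IHp => //.
have := za a; case/orP: rv' => /andP[/eqP-> /eqP->]; last by rewrite rpredBr.
by rewrite rpredBl.
Qed.

(** Rounding the first potential z 0 down and the second z 1 up keeps their sum,
    which is integral: ceil (z 1) = (z 0 + z 1) + ceil (- z 0). *)
Lemma cut_cone_integral (T : 'I_2 -> {set {set V}}) (m : 'I_2 -> {set V} -> rat) :
    weakly_connected src tgt -> (forall i, crossing_family (T i)) ->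
    (forall i U, 0 <= m i U) -> (forall i U, m i U != 0 -> U \in T i) ->
    (forall a, \sum_i cut_sum (m i) (src a) (tgt a) \is a Num.int) ->
  exists n : 'I_2 -> {set V} -> int, [/\ forall i U, 0 <= n i U,
    forall i U, n i U != 0 -> U \in T i &
    forall a, (\sum_i cut_sum (n i) (src a) (tgt a))%:~R =
              \sum_i cut_sum (m i) (src a) (tgt a)].
Proof.
move=> conn Tcross m_ge0 mT m_int.
case: (pickP (fun _ : A => true)) => [a0 _|noA]; last first.
  by exists (fun _ _ => 0); split=> // a; have := noA a.
pose r := src a0.
have [m' m'P] := choice (fun i => uncross (Tcross i) (m_ge0 i) (mT i)).
have m'E i v1 v2 : cut_sum (m' i) v1 v2 = cut_sum (m i) v1 v2.
  have [_ _ _ m'v] := m'P i; rewrite /cut_sum.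
  under eq_bigr do rewrite mulrBr.
  under [RHS]eq_bigr do rewrite mulrBr.
  by rewrite !sumrB !m'v.
pose z i v := cut_sum (m i) v r.
have zr i : z i r = 0 by rewrite /z /cut_sum big1 // => U _; rewrite subrr mulr0.
have z_int v : z 0 v + z 1 v \is a Num.int.
  apply: (@potential_int (fun v => z 0 v + z 1 v) r) => //.
    by rewrite !zr addr0 rpred0.
  move=> a; have := m_int a; rewrite big_ord_recl big_ord1.
  rewrite !(cut_sum_chasles _ (src a) (tgt a) r) -!/(z _ _) (_ : lift _ _ = 1).
    by rewrite addrACA -opprD.
  exact: val_inj.
pose g (i : 'I_2) : rat -> int := if i == 0 then Num.floor else Num.ceil.
have round i : exists n : {set V} -> int, [/\ forall U, 0 <= n U,
    forall U, n U != 0 -> m' i U != 0 &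
    forall v, cut_sum n v r = g i (cut_sum (m' i) v r)].
  have [m'_ge0 _ m'_cf _] := m'P i.
  apply: cross_free_rounding => //; rewrite /g; case: ifP => _.
  - exact: le_floor.
  - exact: le_ceil.
  - exact: floor0.
  - exact: ceil0.
have [n nP] := choice round.
exists n; split=> [i U|i U nU|a].
- by have [n_ge0 _ _] := nP i; exact: n_ge0.
- by have [_ nm _] := nP i; have [_ m'T _ _] := m'P i; apply/m'T/nm.
have roundE v : (\sum_i cut_sum (n i) v r)%:~R = z 0 v + z 1 v.
  rewrite big_ord_recl big_ord1.
  have [_ _ ->] := nP 0; have [_ _ n1] := nP 1.
  rewrite (_ : lift _ _ = 1); last exact: val_inj.
  rewrite n1 /g /= !m'E -!/(z _ _).
  rewrite [in LHS](_ : z 1 v = (z 0 v + z 1 v) - z 0 v); last by ring.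
  by rewrite ceilDzr // (ceilNfloor (- _)) opprK addrCA subrr addr0 ceilK.
under eq_bigr do rewrite (cut_sum_chasles _ _ _ r).
under [RHS]eq_bigr do rewrite (cut_sum_chasles _ _ _ r).
rewrite !sumrB rmorphB /= !roundE !big_ord_recl !big_ord0 !addr0.
by rewrite (_ : lift _ _ = 1) //; apply: val_inj.
Qed.

End CutCones.

(** * The cut system of two crossing submodular functions *)

Section CutSystems.
Variables (V A : finType) (src tgt : A -> V).
Variable C : 'I_2 -> {set {set V}}.

Lemma cut_coefE (r : cut_row C) a : cut_coef src tgt r a =
  (src a \in (val r).2)%:R - (tgt a \in (val r).2)%:R.
Proof. by rewrite /cut_coef !inE; do 2!case: (_ \in _). Qed.

Lemma sum_cut_row (M : nmodType) (G : 'I_2 -> {set V} -> M) :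
    (forall i U, U \notin C i -> G i U = 0) ->
  \sum_(r : cut_row C) G (val r).1 (val r).2 = \sum_i \sum_U G i U.
Proof.
move=> G0; rewrite pair_bigA /= (bigID (fun p => p.2 \in C p.1)) /=.
rewrite [X in _ + X]big1 ?addr0; last by move=> p; exact: G0.
rewrite [RHS](reindex_omap (val : cut_row C -> _) insub) /=.
  by apply: eq_bigl => r; rewrite valK eqxx (valP r).
by move=> p Cp; rewrite insubT.
Qed.

Lemma sum_cut_row_coef (F : pzRingType) (h : {rmorphism rat -> F})
    (m : 'I_2 -> {set V} -> F) a :
    (forall i U, m i U != 0 -> U \in C i) ->
  \sum_(r : cut_row C) h (cut_coef src tgt r a) * m (val r).1 (val r).2 =
  \sum_i cut_sum (m i) (src a) (tgt a).
Proof.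
move=> mC.
rewrite -(@sum_cut_row _ (fun i U => m i U * ((src a \in U)%:R - (tgt a \in U)%:R))).
  apply: eq_bigr => r _; rewrite cut_coefE rmorphB !rmorph_nat.
  do 2!case: (_ \in _);
  by rewrite /= ?subrr ?subr0 ?sub0r ?mulr0 ?mul0r ?mulr1 ?mul1r ?mulrN1 ?mulN1r.
move=> i U; have [->|/mC->//] := eqVneq (m i U) 0; by rewrite mul0r.
Qed.

Variables (f : 'I_2 -> {set V} -> int) (R : realType).

Definition net (x : {ffun A -> R}) (U : {set V}) : R :=
  \sum_(a in arcs_out src tgt U) x a - \sum_(a in arcs_in src tgt U) x a.

Lemma netE x U :
  net x U = \sum_a ((src a \in U)%:R - (tgt a \in U)%:R) * x a.
Proof.
rewrite /net [X in X - _]big_mkcond [X in _ - X]big_mkcond -sumrB.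
apply: eq_bigr => a _; rewrite !inE.
by do 2!case: (_ \in _); rewrite /= ?subrr ?subr0 ?sub0r ?mul0r ?mul1r ?mulN1r.
Qed.

Definition tight_sets (x : {ffun A -> R}) i : {set {set V}} :=
  [set U in C i | net x U == (f i U)%:~R].

Lemma tight_cut_row x (r : cut_row C) :
  tight (cut_coef src tgt (C := C)) (cut_rhs f (C := C)) x r =
  ((val r).2 \in tight_sets x (val r).1).
Proof.
rewrite inE (valP r) /= /tight /cut_rhs ratr_int netE; congr (_ == _).
by apply: eq_bigr => a _; rewrite cut_coefE rmorphB !rmorph_nat.
Qed.

(** The net outflow is modular, so for tight U and W equality holds throughout
    f(U n W) + f(U u W) <= f(U) + f(W) = net(U n W) + net(U u W). *)
Lemma tight_crossing_family (x : {ffun A -> R}) i :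
    crossing_family (C i) -> crossing_submodular (C i) (f i) ->
    cut_polyhedron src tgt C f R x ->
  crossing_family (tight_sets x i).
Proof.
move=> Ccross fsub Px U W.
have net_modular : net x (U :&: W) + net x (U :|: W) = net x U + net x W.
  rewrite !netE -!big_split; apply: eq_bigr => a _ /=; rewrite !inE -!mulrDl.
  by congr (_ * _); do 4!case: (_ \in _); rewrite /=; ring.
rewrite !inE => /andP[UC /eqP Ux] /andP[WC /eqP Wx] UIW UUW.
have /andP[IC JC] := Ccross U W UC WC UIW UUW; rewrite IC JC /=.
have fIJ : (f i (U :&: W))%:~R + (f i (U :|: W))%:~R <=
    (f i U)%:~R + (f i W)%:~R :> R.
  by rewrite -!intrD ler_int; exact: fsub.
have := Px i _ IC; have := Px i _ JC; rewrite -!/(net _ _) => Jx Ix.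
by apply/andP; split; apply/eqP; lra.
Qed.

End CutSystems.

Theorem theorem9 (R : realType) (V A : finType) (src tgt : A -> V)
    (C : 'I_2 -> {set {set V}}) (f : 'I_2 -> {set V} -> int)
    (hD : weakly_connected src tgt)
    (hC : forall i, crossing_family (C i))
    (hf : forall i, crossing_submodular (C i) (f i)) :
  TDI R (cut_coef src tgt (C := C)) (cut_rhs f (C := C)) /\
  integral_polyhedron (cut_polyhedron src tgt C f R).
Proof.
have tdi : TDI R (cut_coef src tgt (C := C)) (cut_rhs f (C := C)).
  move=> w w_int [x xopt].
  pose wz a := Num.floor (w a).
  have wE : w = [ffun a => ratr (wz a)%:~R].
    by apply/ffunP => a; rewrite ffunE ratr_int floorK //; exact: w_int.
  have Px : cut_polyhedron src tgt C f R x by rewrite cut_polyhedronE; case: xopt.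
  have [u [u_ge0 u_tight uw]] : exists u : cut_row C -> rat,
      [/\ forall r, 0 <= u r,
          forall r, u r != 0 ->
            tight (cut_coef src tgt (C := C)) (cut_rhs f (C := C)) x r &
          forall a, \sum_r cut_coef src tgt r a * u r = (wz a)%:~R].
    by apply: optimum_tight_cone; rewrite -wE.
  pose T := tight_sets src tgt C f x.
  pose m i U := if insub (i, U) is Some r then u r else 0.
  have mE r : m (val r).1 (val r).2 = u r by rewrite /m -surjective_pairing valK.
  have mT i U : m i U != 0 -> U \in T i.
    rewrite /m; case: insubP => [r _ rE /u_tight|_]; last by rewrite eqxx.
    by rewrite tight_cut_row rE.
  have m_ge0 i U : 0 <= m i U by rewrite /m; case: insubP.
  have TC i U : U \in T i -> U \in C i by rewrite inE => /andP[].
  have mw a : \sum_i cut_sum (m i) (src a) (tgt a) = (wz a)%:~R.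
    rewrite -(sum_cut_row_coef src tgt (C := C) idfun) => [|i U /mT/TC//].
    by rewrite -uw; apply: eq_bigr => r _; rewrite mE.
  have [|a|n [n_ge0 nT nw]] := @cut_cone_integral _ _ src tgt T m hD _ m_ge0 mT.
  - by move=> i; exact: tight_crossing_family.
  - by rewrite mw intr_int.
  pose v : {ffun cut_row C -> R} := [ffun r => (n (val r).1 (val r).2)%:~R].
  have Dv : dual_feasible (cut_coef src tgt (C := C)) w v.
    split=> [r|a]; first by rewrite ffunE ler0z.
    rewrite wE ffunE ratr_int.
    have := nw a; rewrite mw => /intr_inj <-.
    rewrite rmorph_sum.
    transitivity (\sum_i cut_sum (fun U => (n i U)%:~R : R) (src a) (tgt a)).
      rewrite -(sum_cut_row_coef src tgt (C := C) (ratr : {rmorphism rat -> R})).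
        by apply: eq_bigr => r _; rewrite ffunE.
      by move=> i U; rewrite intr_eq0 => /nT/TC.
    apply: eq_bigr => i _; rewrite rmorph_sum; apply: eq_bigr => U _.
    by rewrite rmorphM rmorphB !rmorph_nat.
  have [|_ [_ vopt]] := slackness xopt.1 Dv.
    by move=> r; rewrite ffunE intr_eq0 tight_cut_row => /nT.
  by exists v => // r; rewrite ffunE intr_int.
split=> //; rewrite cut_polyhedronE.
pose B (r : cut_row C) a : int :=
  (a \in arcs_out src tgt (val r).2)%:R - (a \in arcs_in src tgt (val r).2)%:R.
have BE : cut_coef src tgt (C := C) = fun r a => (B r a)%:~R.
  by apply/funext => r; apply/funext => a; rewrite rmorphB !rmorph_nat.
rewrite BE in tdi *; exact: TDI_integral_polyhedron.
Qed.
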